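(* Let $K$ be an infinite field of characteristic different from $2$ and $3$, and let $A=Ke\oplus U\oplus V$ be a Bernstein algebra over $K$ with $N=\ker\omega=U\oplus V$. The following conditions are equivalent: (i) $A$ is a train algebra; (ii) for all $v\in V$, the operators $L_v:U\to U$ are nilpotent with bounded nil-indexes; (iii) for all $v\in V$, the operators $L_v:L(A)\to L(A)$ are nilpotent with bounded nil-indexes; (iv) for all $x\in N$, the operators $L_x:N\to N$ are nilpotent with bounded nil-indexes; (v) $N$ is a nil-algebra of bounded nil-index. In this case, if the rank $r$ of $A$ is at least $3$, the train equation of $A$ has the form $(x^3-\omega(x)x^2)\left(x-\tfrac12\omega(x)\right)^{r-3}=0$, meaning that $\left(L_x-\tfrac12\omega(x)\,\mathrm{id}_A\right)^{r-3}(x^3-\omega(x)x^2)=0$ for all $x\in A$.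
   Context: Algebras are not assumed associative, unital or finite-dimensional. A Bernstein algebra over $K$ is a commutative $K$-algebra $A$ with a nonzero algebra homomorphism $\omega:A\to K$ satisfying $(x^2)^2=\omega(x)^2x^2$ for all $x$. Here $e$ is a nonzero idempotent of $A$ (necessarily $\omega(e)=1$) and $A=Ke\oplus U\oplus V$ is the Peirce decomposition: $U=\{u\in A:2eu=u\}$, $V=\{v\in A:ev=0\}$; one has $UV\subseteq U$. The Lyubich ideal is $L(A)=\{u\in U:uU=0\}$; it is an ideal of $A$ independent of $e$. $L_x$ denotes multiplication by $x$. ''Bounded nil-indexes'' means there is one integer $k$ such that the $k$-th power of every operator in question is zero. Principal powers: $x^1=x$, $x^{k+1}=x^kx$. $N$ is nil of bounded nil-index if there is $n$ with $x^n=0$ for all $x\in N$. A commutative algebra with weight function $\omega$ is a train algebra of rank $r$ if there are $\gamma_1,\dots,\gamma_{r-1}\in K$ with $x^r+\gamma_1\omega(x)x^{r-1}+\cdots+\gamma_{r-1}\omega(x)^{r-1}x=0$ for all $x$ (the train equation), where $r\ge2$ is the smallest integer for which such an equation holds. *)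

(* Defs.v *)
From HB Require Import structures.
From mathcomp Require Import all_boot all_order all_algebra.
From mathcomp Require Import mathcomp_extra boolp classical_sets functions.
From mathcomp Require Import cardinality.
Set Implicit Arguments.
Unset Strict Implicit.
Unset Printing Implicit Defensive.
Import GRing.Theory.
Local Open Scope classical_set_scope.
Local Open Scope ring_scope.

(* A nonassociative, nonunital algebra, possibly of infinite dimension, is a
   K-module A with a bilinear product mul : {bilinear A -> A -> A}; the
   operator L_x is mul x. *)

Section BernsteinAlgebras.
Variables (K : fieldType) (A : lmodType K).
Variables (mul : {bilinear A -> A -> A}) (omega : {scalar A}).

Definition weight_function :=
  (exists x, omega x != 0) /\ forall x y, omega (mul x y) = omega x * omega y.

Definition bernstein_algebra :=
  [/\ commutative mul, weight_function &
      forall x, mul (mul x x) (mul x x) = omega x ^+ 2 *: mul x x].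

(* Junk value: ppow x 0 = x. Only exponents n >= 1 are meaningful. *)
Definition ppow (x : A) (n : nat) : A := iter n.-1 (fun y => mul y x) x.

(* Only the coefficients gamma 1, ..., gamma r.-1 are used. *)
Definition train_equation (r : nat) (gamma : nat -> K) :=
  forall x : A, ppow x r +
    \sum_(1 <= i < r) (gamma i * omega x ^+ i) *: ppow x (r - i)%N = 0.

Definition train_rank (r : nat) :=
  [/\ (2 <= r)%N, exists gamma, train_equation r gamma &
      forall s gamma, (2 <= s)%N -> train_equation s gamma -> (r <= s)%N].

Definition train_algebra := exists r, train_rank r.

Definition peirceU (e : A) : set A := [set u | mul e u *+ 2 = u].

Definition peirceV (e : A) : set A := [set v | mul e v = 0].

Definition lyubich_ideal (e : A) : set A :=
  [set u | peirceU e u /\ forall w, peirceU e w -> mul u w = 0].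

Definition barideal : set A := [set x | omega x = 0].

(* T is the set of operators' indices, and S a subspace stable under every
   L_t with t in T: the k-th power of L_t restricted to S is zero. *)
Definition bounded_nilpotent_mul (T S : set A) :=
  exists k : nat, forall t s, T t -> S s -> iter k (mul t) s = 0.

Definition bounded_nil (S : set A) :=
  exists2 n : nat, (0 < n)%N & forall x, S x -> ppow x n = 0.

End BernsteinAlgebras.

(* Main.v *)
(* Linearising the Bernstein identity at x = e + t n gives e U^2 = 0,
   V^2 <= L := L(A), u (w v) = - w (u v), (u v)(w v) = 0 and
   2 u (u w) = - u^2 w for u, w in U and v in V. Hence v (v u) lies in L, so
   L_n^3 maps N into L for n = u + v, while L_n agrees with L_v on L: nilpotency
   on L gives nilpotency on N. Conversely the part of (v + t u)^(k + 1) linear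
   in t is 2 t L_v^k u, because the powers of v beyond the first lie in L.

   If omega x = 1, then f = x^2 is idempotent and x = f + u + v with u in the
   Lyubich ideal (Peirce components with respect to f), so
   (L_x - 1/2)^m (x^3 - x^2) = L_v^m u / 2, which vanishes for some m
   independent of x as soon as N is nil of bounded index. The train polynomial
   of minimal degree, divided by X, then divides X (X - 1) (X - 1/2)^m; 1 is a
   root because of e, and if 0 were not a root, then V = 0 and the rank
   would be 2. *)
Require Import Defs.
From HB Require Import structures.
From mathcomp Require Import all_boot all_order all_algebra.
From mathcomp Require Import mathcomp_extra boolp classical_sets functions.
From mathcomp Require Import cardinality.
Set Implicit Arguments.
Unset Strict Implicit.
Unset Printing Implicit Defensive.
Import GRing.Theory.
Local Open Scope classical_set_scope.
Local Open Scope ring_scope.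

(** * Polynomial curves in a vector space *)

Section InfiniteField.
Variable K : fieldType.
Hypothesis K_infinite : infinite_set [set: K].

Lemma infinite_field_nonroot (p : {poly K}) : p != 0 -> exists q, ~~ root p q.
Proof.
move=> p_neq0; apply: contrapT => noroot.
have proot x : root p x.
  by apply: contrapT => /negP px; apply: noroot; exists x.
have [B _ sizeB] := infinite_set_fset (size p) K_infinite.
have Broot : all (root p) (finmap.enum_fset B) by exact/allP.
have := max_poly_roots p_neq0 Broot (finmap.fset_uniq B).
by rewrite ltnNge sizeB.
Qed.

Section PolynomialCurves.
Variable A : lmodType K.

(** The coefficients stay existential: iterated products along a line are shown to be polynomial in
    [t] by closure lemmas, with no expansion. *)
Definition polynomial_curve (f : K -> A) :=
  exists n (a : nat -> A), forall t, f t = \sum_(i < n) t ^+ i *: a i.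

Lemma curve_cst a : polynomial_curve (fun _ => a).
Proof. by exists 1, (fun=> a) => t; rewrite big_ord1 expr0 scale1r. Qed.

Lemma curve_shift f :
  polynomial_curve f -> polynomial_curve (fun t => t *: f t).
Proof.
move=> [n [a fE]]; exists n.+1, (fun i => if i is j.+1 then a j else 0) => t.
rewrite big_ord_recl scaler0 add0r fE scaler_sumr.
by apply: eq_bigr => i _; rewrite scalerA -exprS.
Qed.

Lemma curve_exp k f :
  polynomial_curve f -> polynomial_curve (fun t => t ^+ k *: f t).
Proof.
move=> fc; elim: k => [|k /curve_shift].
  by move: fc; congr polynomial_curve; apply/funext => t; rewrite expr0 scale1r.
by congr polynomial_curve; apply/funext => t; rewrite exprS scalerA.
Qed.

Lemma curveD f g : polynomial_curve f -> polynomial_curve g ->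
  polynomial_curve (fun t => f t + g t).
Proof.
move=> [n [a fE]] [m [b gE]].
exists (maxn n m), (fun i => (if (i < n)%N then a i else 0) +
                             (if (i < m)%N then b i else 0)) => t.
rewrite fE gE (big_ord_widen (maxn n m) (fun i => t ^+ i *: a i)) ?leq_maxl//.
rewrite (big_ord_widen (maxn n m) (fun i => t ^+ i *: b i)) ?leq_maxr//.
rewrite big_mkcond [X in _ + X]big_mkcond -big_split; apply: eq_bigr => i _ /=.
by rewrite scalerDr; case: ifP; case: ifP; rewrite ?scaler0.
Qed.

Lemma curve_linear (g : {linear A -> A}) f :
  polynomial_curve f -> polynomial_curve (fun t => g (f t)).
Proof.
move=> [n [a fE]]; exists n, (g \o a) => t.
by rewrite fE linear_sum; apply: eq_bigr => i _; rewrite linearZ.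
Qed.

Lemma curve_sum n (F : 'I_n -> K -> A) :
  (forall i, polynomial_curve (F i)) ->
  polynomial_curve (fun t => \sum_i F i t).
Proof.
elim: n F => [|n IHn] F Fc.
  by exists 0, (fun=> 0) => t; rewrite !big_ord0.
have := curveD (Fc ord0) (IHn _ (fun i => Fc (lift ord0 i))).
by congr polynomial_curve; apply/funext => t; rewrite big_ord_recl.
Qed.

(* If q ^+ n != 1, then f (q t) - q ^+ n f t has lower degree than f, and its
   constant term is (1 - q ^+ n) f 0. *)
Lemma curve_eq0 f : polynomial_curve f ->
  (forall t, t != 0 -> f t = 0) -> f 0 = 0.
Proof.
move=> [n [a fE]] f0; have {}f0 t : t != 0 -> \sum_(i < n) t ^+ i *: a i = 0.
  by rewrite -fE; exact: f0.
case: n f0 fE => [|n] f0 ->; first by rewrite big_ord0.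
rewrite big_ord_recl expr0 scale1r big1 ?addr0; last first.
  by move=> i _; rewrite expr0n scale0r.
elim: n a f0 => [|n IHn] a f0.
  by have := f0 1 (oner_neq0 _); rewrite big_ord1 expr0 scale1r.
(* The factor ['X] makes [q] nonzero, so that [q * t] stays where the hypothesis applies. *)
have [|q] := @infinite_field_nonroot ('X * ('X^(n.+1) - 1%:P)).
  by rewrite mulf_neq0 ?polyX_eq0// -size_poly_eq0 size_XnsubC.
rewrite rootM !rootE !hornerE negb_or subr_eq0 [_ == 1]eq_sym => /andP[q_neq0 qn_neq1].
have : (1 - q ^+ n.+1) *: a 0 = 0.
  rewrite -[1](expr0 q); apply: (IHn (fun i => (q ^+ i - q ^+ n.+1) *: a i)).
  move=> t t_neq0; pose F i := ((q * t) ^+ i - q ^+ n.+1 * t ^+ i) *: a i.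
  rewrite (eq_bigr (fun i : 'I_n.+1 => F i)) => [|i _]; last first.
    by rewrite /F scalerA mulrC mulrBl exprMn.
  transitivity (\sum_(i < n.+2) F i).
    by rewrite [RHS]big_ord_recr [F ord_max]/F exprMn subrr scale0r /= addr0.
  rewrite /F; under eq_bigr do rewrite scalerBl -scalerA.
  by rewrite sumrB -scaler_sumr (f0 _ t_neq0) f0 ?mulf_neq0// scaler0 subrr.
by move=> /eqP; rewrite scaler_eq0 subr_eq0 (negPf qn_neq1) => /eqP.
Qed.

(** Peels the constant coefficient off an expression in Horner form. Vanishing is asked for [t != 0]
    only, so one may divide by [t] and peel again. *)
Lemma curve_cons0 a f : polynomial_curve f ->
  (forall t, t != 0 -> a + t *: f t = 0) ->
  a = 0 /\ forall t, t != 0 -> f t = 0.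
Proof.
move=> fc af; have a0 : a = 0.
  have := curve_eq0 (curveD (curve_cst a) (curve_shift fc)) af.
  by rewrite scale0r addr0.
split=> // t t_neq0; have /eqP := af t t_neq0.
by rewrite a0 add0r scaler_eq0 (negPf t_neq0) => /eqP.
Qed.

End PolynomialCurves.
End InfiniteField.

(** * Division by two *)

Section Additive.
Variables (K : fieldType) (A : lmodType K).
Hypothesis two_neq0 : 2%:R != 0 :> K.

Lemma double_eq0 (x : A) : x *+ 2 = 0 -> x = 0.
Proof.
by move/eqP; rewrite -scaler_nat scaler_eq0 (negPf two_neq0) => /eqP.
Qed.

(** Applied to an identity and its copy with one variable negated, this separates the even part from
    the odd part. *)
Lemma add_sub_eq0 (x y : A) : x + y = 0 -> x - y = 0 -> x = 0 /\ y = 0.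
Proof.
move=> xDy xBy; have x0 : x = 0.
  apply: double_eq0; rewrite mulr2n -[x in X in X + _](addrK y).
  by rewrite xDy sub0r addrC xBy.
by split=> //; rewrite x0 add0r in xDy.
Qed.

End Additive.

(** * Peirce decomposition of a Bernstein algebra *)

Section Bernstein.
Variables (K : fieldType) (A : lmodType K).
Variables (mul : {bilinear A -> A -> A}) (omega : {scalar A}).
Hypothesis K_infinite : infinite_set [set: K].
Hypothesis two_neq0 : 2%:R != 0 :> K.
Hypothesis A_bernstein : bernstein_algebra mul omega.

Local Notation "x ** y" := (mul x y) (at level 40, left associativity).

Let mulC : commutative mul. Proof. by case: A_bernstein. Qed.
Let omegaM x y : omega (x ** y) = omega x * omega y.
Proof. by case: A_bernstein => _ []. Qed.
Let bernsteinE x : (x ** x) ** (x ** x) = omega x ^+ 2 *: (x ** x).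
Proof. by case: A_bernstein. Qed.

Let mulDl x y z : (x + y) ** z = x ** z + y ** z.
Proof. exact: linearDl. Qed.
Let mulDr x y z : z ** (x + y) = z ** x + z ** y.
Proof. exact: linearD. Qed.
Let mulNr x y : x ** - y = - (x ** y). Proof. exact: linearN. Qed.
Let mulNl x y : - x ** y = - (x ** y). Proof. exact: linearNl. Qed.
Let mulZl a x y : (a *: x) ** y = a *: (x ** y). Proof. exact: linearZl_LR. Qed.
Let mulZr a x y : x ** (a *: y) = a *: (x ** y). Proof. exact: linearZr_LR. Qed.
Let mul0r x : x ** 0 = 0. Proof. exact: linear0. Qed.
Let mulMnr n x y : x ** (y *+ n) = (x ** y) *+ n. Proof. exact: linearMn. Qed.
Let mulMnl n x y : (x *+ n) ** y = (x ** y) *+ n. Proof. exact: linearMnl. Qed.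

Lemma sqrD x y : (x + y) ** (x + y) = x ** x + (x ** y) *+ 2 + y ** y.
Proof. by rewrite mulDl !mulDr [y ** x]mulC mulr2n !addrA. Qed.

(** Twice [x ** y] is the square of [x + y] minus the squares of [x] and [y]. [S] may be a Peirce
    component or a set of multiples such as [u ** V]; [g] encodes the linear condition known for
    squares. *)
Lemma polarization (S : A -> Prop) (g : A -> A) :
  (forall x y, S x -> S y -> S (x + y)) -> {morph g : x y / x + y} ->
  (forall x, S x -> g (x ** x) = 0) ->
  forall x y, S x -> S y -> g (x ** y) = 0.
Proof.
move=> SD gD g0 x y Sx Sy; apply: (double_eq0 two_neq0).
have := g0 _ (SD _ _ Sx Sy); rewrite sqrD !gD !g0 // add0r addr0.
by [].
Qed.

Section Idempotent.
Variable e : A.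
Hypotheses (e_idem : e ** e = e) (omega_e : omega e = 1).

Local Notation U := (peirceU mul e).
Local Notation V := (peirceV mul e).
Local Notation L := (lyubich_ideal mul e).

(* Compare the coefficients of t in the Bernstein identity for x = e + t n. *)
Lemma bernstein_linearized n : omega n = 0 ->
  [/\ e ** ((e ** n) *+ 2) *+ 2 = (e ** n) *+ 2,
      e ** (n ** n) *+ 2 + ((e ** n) *+ 2) ** ((e ** n) *+ 2) = n ** n,
      ((e ** n) *+ 2) ** (n ** n) = 0 &
      (n ** n) ** (n ** n) = 0].
Proof.
move=> n0; set b := (e ** n) *+ 2; set c := n ** n.
pose G1 := (e ** b) *+ 2 - b; pose G2 := (e ** c) *+ 2 + b ** b - c.
pose G3 := (b ** c) *+ 2; pose G4 := c ** c.
(* The square of [e + t *: n] is [e + t b + t^2 c]. Squaring again, subtracting it and dividing by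
   [t] gives this Horner form. *)
have G0 t : t != 0 -> G1 + t *: (G2 + t *: (G3 + t *: G4)) = 0.
  move=> t_neq0; have := bernsteinE (e + t *: n).
  have -> : omega (e + t *: n) = 1.
    by rewrite linearD linearZ omega_e n0 /= mulr0 addr0.
  rewrite expr1n scale1r.
  move/eqP; rewrite -subr_eq0 => sq0.
  apply/eqP; rewrite -[_ == 0]/(false || _) -(negPf t_neq0) -scaler_eq0.
  rewrite -(eqP sq0); apply/eqP.
  have -> : (e + t *: n) ** (e + t *: n) = e + t *: b + t *: (t *: c).
    by rewrite sqrD e_idem mulZl !mulZr scalerMnr /b /c.
  rewrite [in RHS]sqrD [in RHS]sqrD e_idem mulDl !(mulZl, mulZr).
  rewrite /G1 /G2 /G3 /G4; apply/eqP; rewrite eq_sym subr_eq; apply/eqP.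
  rewrite !(scalerDr, scalerN, scalerMnr, scalerA, mulrnDl, addrA).
  rewrite [RHS](ACl (11*1*2*6*4*8*5*9*10*((12*13)*3)*(14*7)))/=.
  by rewrite !subrr !addr0.
have curve3 : polynomial_curve (fun t => G3 + t *: G4).
  exact/curveD/curve_shift/curve_cst/curve_cst.
have curve2 : polynomial_curve (fun t => G2 + t *: (G3 + t *: G4)).
  exact/curveD/curve_shift/curve3/curve_cst.
have [/subr0_eq G1_eq0 {}G0] := curve_cons0 K_infinite curve2 G0.
have [/subr0_eq G2_eq0 {}G0] := curve_cons0 K_infinite curve3 G0.
have [G3_eq0 G4_eq0] := curve_cons0 K_infinite (curve_cst G4) G0.
split=> //; first exact: (double_eq0 two_neq0).
exact: (G4_eq0 1 (oner_neq0 _)).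
Qed.

Lemma peirceUD x y : U x -> U y -> U (x + y).
Proof. by rewrite /peirceU /= => Ux Uy; rewrite mulDr mulrnDl Ux Uy. Qed.

Lemma peirceUZ a x : U x -> U (a *: x).
Proof. by rewrite /peirceU /= => Ux; rewrite mulZr scalerMnr Ux. Qed.

Lemma peirceU0 : U 0.
Proof. by rewrite /peirceU /= mul0r mul0rn. Qed.

Lemma peirceUN x : U x -> U (- x).
Proof. by rewrite -scaleN1r; exact: peirceUZ. Qed.

Lemma peirceVD x y : V x -> V y -> V (x + y).
Proof. by rewrite /peirceV /= => Vx Vy; rewrite mulDr Vx Vy addr0. Qed.

Lemma peirceV0 : V 0.
Proof. exact: mul0r. Qed.

Lemma peirceVN x : V x -> V (- x).
Proof. by rewrite /peirceV /= => Vx; rewrite mulNr Vx oppr0. Qed.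

Lemma peirceUV_eq0 x : U x -> V x -> x = 0.
Proof. by rewrite /peirceU /peirceV /= => Ux Vx; rewrite -Ux Vx mul0rn. Qed.

Lemma peirceU_weight u : U u -> omega u = 0.
Proof.
move=> Uu; have := congr1 omega Uu.
rewrite linearMn omegaM omega_e mul1r mulr2n => h.
by apply: (addrI (omega u)); rewrite h addr0.
Qed.

Lemma peirceV_weight v : V v -> omega v = 0.
Proof. by move=> Vv; rewrite -[omega v]mul1r -omega_e -omegaM Vv linear0. Qed.

Lemma peirce_weight u v : U u -> V v -> omega (u + v) = 0.
Proof.
by move=> Uu Vv; rewrite linearD peirceU_weight // peirceV_weight //= addr0.
Qed.

(** On weight zero [2 L_e] is idempotent, by the part of the Bernstein identity linear in [n]; it
    projects onto U along V. *)
Lemma peirce_decomposition n :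
  omega n = 0 -> exists u v, [/\ U u, V v & n = u + v].
Proof.
move=> n0; have [Ub _ _ _] := bernstein_linearized n0.
exists ((e ** n) *+ 2), (n - (e ** n) *+ 2); split=> //; last by rewrite addrC subrK.
rewrite /peirceV /= mulDr mulNr; apply: (double_eq0 two_neq0).
by rewrite mulrnDl mulNrn Ub subrr.
Qed.

Lemma bernstein_peirce u v (n := u + v) : U u -> V v ->
  [/\ (e ** (n ** n)) *+ 2 + u ** u = n ** n,
      u ** (n ** n) = 0 & (n ** n) ** (n ** n) = 0].
Proof.
move=> Uu Vv; have := bernstein_linearized (peirce_weight Uu Vv).
suff -> : (e ** (u + v)) *+ 2 = u by case.
by rewrite mulDr Vv addr0.
Qed.

(** * Products of the Peirce components *)

Lemma mulUU u w : U u -> U w -> V (u ** w).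
Proof.
move: u w; apply: (polarization (S := U)) => [|x y|u Uu]; first exact: peirceUD.
  exact: mulDr.
have [] := bernstein_peirce Uu peirceV0; rewrite addr0 => h _ _.
by apply: (double_eq0 two_neq0); apply: (addIr (u ** u)); rewrite add0r.
Qed.

Lemma mulVV v w : V v -> V w -> U (v ** w).
Proof.
move=> Vv Vw; apply/subr0_eq; move: v w Vv Vw.
apply: (polarization (S := V) (g := fun z => (e ** z) *+ 2 - z)) => [|x y|v Vv].
- exact: peirceVD.
- by rewrite mulDr mulrnDl opprD addrACA.
have [] := bernstein_peirce peirceU0 Vv; rewrite add0r mul0r addr0 => -> _ _.
exact: subrr.
Qed.

(** In the relation for [u + v] the terms [u ** u] and [v ** v] cancel by the two previous rules;
    what remains is the condition on [u ** v], doubled. *)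
Lemma mulUV u v : U u -> V v -> U (u ** v).
Proof.
move=> Uu Vv; have [+ _ _] := bernstein_peirce Uu Vv.
rewrite sqrD mulDr mulDr (mulUU Uu Uu) add0r mulrnDl (mulVV Vv Vv).
rewrite [LHS](ACl (1*(2*3))) [RHS](ACl (2*(3*1)))/= mulMnr => /addIr h.
apply/subr0_eq/(double_eq0 two_neq0).
by rewrite mulrnDl mulNrn h subrr.
Qed.

Lemma mulVU u v : U u -> V v -> U (v ** u).
Proof. by rewrite mulC; exact: mulUV. Qed.

Lemma cubeU_eq0 u : U u -> u ** (u ** u) = 0.
Proof. by move=> /bernstein_peirce/(_ peirceV0)[_]; rewrite addr0. Qed.

(** In [u (u + v)^2 = 0] the term [u (v v)] is even in [v] and [2 u (u v)] is odd; replacing [v] by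
    [- v] separates them. *)
Lemma mul_u_uv_vv u v : U u -> V v -> u ** (v ** v) = 0 /\ u ** (u ** v) = 0.
Proof.
move=> Uu Vv.
have key w : V w -> u ** (w ** w) + u ** (u ** w) *+ 2 = 0.
  move=> Vw; have [_ + _] := bernstein_peirce Uu Vw.
  by rewrite sqrD mulDr mulDr cubeU_eq0 // add0r addrC mulMnr.
have := key _ (peirceVN Vv); rewrite mulNl !mulNr opprK mulNrn => hm.
have [-> h] := add_sub_eq0 two_neq0 (key _ Vv) hm.
by split=> //; exact: double_eq0 h.
Qed.

Lemma mulU_VV u v w : U u -> V v -> V w -> u ** (v ** w) = 0.
Proof.
move=> Uu; move: v w; apply: (polarization (S := V)); first exact: peirceVD.
  by move=> x y; rewrite mulDr.
by move=> v Vv; have [] := mul_u_uv_vv Uu Vv.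
Qed.

Lemma mulU_UV u w v : U u -> U w -> V v -> u ** (w ** v) = - (w ** (u ** v)).
Proof.
move=> Uu Uw Vv; apply/eqP; rewrite -addr_eq0; apply/eqP.
have [_] := mul_u_uv_vv (peirceUD Uu Uw) Vv; rewrite !mulDl !mulDr.
have [_ ->] := mul_u_uv_vv Uu Vv; have [_ ->] := mul_u_uv_vv Uw Vv.
by rewrite add0r addr0.
Qed.

(** This is the part of [(u + w)^3 = 0] linear in [w]; the quadratic part has the other parity and
    is split off by negating [w]. *)
Lemma cubeU_polarized u w : U u -> U w ->
  (u ** (u ** w)) *+ 2 = - ((u ** u) ** w).
Proof.
move=> Uu Uw; apply/eqP; rewrite -addr_eq0; apply/eqP.
have key x : U x ->
    (u ** (x ** x) + x ** (u ** x) *+ 2) + (u ** (u ** x) *+ 2 + (u ** u) ** x) = 0.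
  move=> Ux; have := cubeU_eq0 (peirceUD Uu Ux).
  rewrite sqrD !mulr2n !mulDl !mulDr !cubeU_eq0 // add0r addr0 [x ** (u ** u)]mulC.
  by rewrite !addrA [X in X = 0 -> _](ACl (3*5*6*1*2*4)).
have hp := key _ Uw; have := key _ (peirceUN Uw).
rewrite !(mulNl, mulNr) !opprK !mulNrn -opprD => hm.
by have [] := add_sub_eq0 two_neq0 hp hm.
Qed.

(** * The Lyubich ideal *)

Lemma lyubich_U u : L u -> U u.
Proof. by case. Qed.

Lemma lyubich_mulU u w : L u -> U w -> u ** w = 0.
Proof. by move=> [_]; exact. Qed.

Lemma lyubichD x y : L x -> L y -> L (x + y).
Proof.
move=> [Ux xU] [Uy yU]; split=> [|w Uw]; first exact: peirceUD.
by rewrite mulDl xU // yU // addr0.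
Qed.

Lemma lyubichZ a x : L x -> L (a *: x).
Proof.
move=> [Ux xU]; split=> [|w Uw]; first exact: peirceUZ.
by rewrite mulZl xU // scaler0.
Qed.

Lemma lyubichN x : L x -> L (- x).
Proof. by rewrite -scaleN1r; exact: lyubichZ. Qed.

Lemma lyubichMn x k : L x -> L (x *+ k).
Proof. by rewrite -scaler_nat; exact: lyubichZ. Qed.

Lemma lyubich_half x : L (x *+ 2) -> L x.
Proof.
by move=> /(lyubichZ (2%:R^-1)); rewrite -scaler_nat scalerA mulVf // scale1r.
Qed.

Lemma lyubich_mulVV v w : V v -> V w -> L (v ** w).
Proof.
move=> Vv Vw; split=> [|u Uu]; first exact: mulVV.
by rewrite mulC mulU_VV.
Qed.

Lemma lyubich_mulV l v : L l -> V v -> L (v ** l).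
Proof.
move=> Ll Vv; have Ul := lyubich_U Ll; split=> [|u Uu]; first exact: mulVU.
by rewrite mulC [v ** l]mulC mulU_UV // lyubich_mulU ?oppr0//; exact: mulUV.
Qed.

Lemma lyubich_mul u v l : U u -> V v -> L l -> (u + v) ** l = v ** l.
Proof. by move=> Uu Vv Ll; rewrite mulDl [u ** l]mulC lyubich_mulU // add0r. Qed.

(** Expand [n^2 n^2 = 0] for [n = u + v]. Only [(2 u v)^2], in V, and [2 u^2 (2 u v + v^2)], in U,
    survive, so each of them is zero. *)
Lemma sqrUV_eq0 u v : U u -> V v -> (u ** v) ** (u ** v) = 0.
Proof.
move=> Uu Vv; have [_ _ pp] := bernstein_peirce Uu peirceV0; rewrite addr0 in pp.
have [_ _] := bernstein_peirce Uu Vv; rewrite sqrD.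
set p := u ** u; set q := (u ** v) *+ 2; set r := v ** v.
have Uq : U q by rewrite /q mulr2n; apply: peirceUD; exact: mulUV.
have Ur : U r := mulVV Vv Vv.
have Vp : V p := mulUU Uu Uu.
have U2 x : U x -> U (x *+ 2) by rewrite mulr2n => Ux; exact: peirceUD.
rewrite -addrA sqrD pp add0r sqrD addrA addrAC.
rewrite (mulU_VV Uq) // (mulU_VV Ur) // mul0rn !addr0 => /eqP.
rewrite addrC addr_eq0 => /eqP qqE.
have qq0 : q ** q = 0.
  apply: peirceUV_eq0 (mulUU Uq Uq); rewrite qqE.
  exact/peirceUN/U2/mulVU/Vp/peirceUD.
move: qq0; rewrite /q mulMnl mulMnr => h.
by do 2!apply: (double_eq0 two_neq0).
Qed.

Lemma mulUV_UV_eq0 u v w : U u -> V v -> V w -> (u ** v) ** (u ** w) = 0.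
Proof.
move=> Uu Vv Vw.
apply: (polarization (S := fun z => exists2 v, V v & z = u ** v) (g := id)).
- move=> _ _ [x Vx ->] [y Vy ->]; exists (x + y); first exact: peirceVD.
  by rewrite mulDr.
- by [].
- by move=> _ [x Vx ->]; exact: sqrUV_eq0.
- by exists v.
- by exists w.
Qed.

Lemma mulUV_VU_eq0 u w v : U u -> U w -> V v -> (u ** v) ** (w ** v) = 0.
Proof.
move=> Uu Uw Vv.
apply: (polarization (S := fun z => exists2 u, U u & z = u ** v) (g := id)).
- move=> _ _ [x Vx ->] [y Vy ->]; exists (x + y); first exact: peirceUD.
  by rewrite mulDl.
- by [].
- by move=> _ [x Vx ->]; exact: sqrUV_eq0.
- by exists u.
- by exists w.
Qed.

Lemma lyubich_VVU u v : U u -> V v -> L (v ** (v ** u)).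
Proof.
move=> Uu Vv; split=> [|w Uw]; first exact/mulVU/Vv/mulVU.
have Uuv := mulUV Uu Vv.
by rewrite mulC ![v ** _]mulC mulU_UV // mulUV_VU_eq0 ?oppr0.
Qed.

Lemma lyubich_VVU_polarized u v w : U u -> V v -> V w ->
  L (v ** (w ** u) + w ** (v ** u)).
Proof.
move=> Uu Vv Vw; have := lyubich_VVU Uu (peirceVD Vv Vw).
rewrite !mulDl !mulDr.
have Lv := lyubichN (lyubich_VVU Uu Vv); have Lw := lyubichN (lyubich_VVU Uu Vw).
move=> /(lyubichD Lv)/lyubichD/(_ Lw).
by rewrite !addrA [X in L X](ACl ((1*2)*(3*4)*(5*6)))/= addNr add0r subrr addr0.
Qed.

(** * Multiplication operators on the kernel of the weight *)

Section Barideal.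
Variables (u v : A).
Hypotheses (Uu : U u) (Vv : V v).
Local Notation n := (u + v).

Lemma lyubich_mulN l : L l -> L (n ** l).
Proof. by move=> Ll; rewrite lyubich_mul //; exact: lyubich_mulV. Qed.

(** The summand [v ** w] is already in the ideal. From [u ** w] the other two factors produce only
    [v (v (u w))], since [u (u w)] and [u (v (u w))] vanish. *)
Lemma lyubich_mulN3_V w : V w -> L (n ** (n ** (n ** w))).
Proof.
move=> Vw; have Uuw := mulUV Uu Vw.
rewrite (mulDl _ _ w) (mulDr _ (v ** w)) (mulDr _ (n ** (v ** w))).
apply: lyubichD; last first.
  exact/lyubich_mulN/lyubich_mulN/lyubich_mulVV.
have -> : n ** (u ** w) = v ** (u ** w).
  by rewrite mulDl; have [_ ->] := mul_u_uv_vv Uu Vw; rewrite add0r.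
rewrite mulDl [v ** (u ** w)]mulC mulU_UV // mulUV_UV_eq0 // oppr0 add0r mulC.
by rewrite [_ ** v]mulC [_ ** v]mulC; exact: lyubich_VVU.
Qed.

Lemma lyubich_mulN3_U w : U w -> L (n ** (n ** (n ** w))).
Proof.
move=> Uw; have Vuw := mulUU Uu Uw; have Uvw := mulVU Uw Vv.
rewrite (mulDl _ _ w) (mulDr _ (v ** w)) (mulDl _ _ (u ** w)).
rewrite (mulDl _ _ (v ** w)) !mulDr.
have Lvuw := lyubich_mulN (lyubich_mulVV Vv Vuw).
have Lvvw := lyubich_mulN (lyubich_VVU Uw Vv).
(* The words starting from [v (u w)] or [v (v w)] are in the ideal. The words [u u u], [v u u],
   [u u v] and [v u v] remain. *)
rewrite addrACA; apply: lyubichD; last exact: lyubichD.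
have uuuw0 : u ** (u ** (u ** w)) = 0.
  apply: (double_eq0 two_neq0); rewrite -mulMnr cubeU_polarized // mulNr.
  by rewrite [_ ** w]mulC mulU_UV // ?cubeU_eq0 ?mul0r ?oppr0//; exact: mulUU.
rewrite !mulDl uuuw0 add0r addrA; apply: lyubichD; last first.
  exact/lyubich_mulVV/mulUU/Uvw.
(* With [p = u ** u] in V, twice [v (u (u w)) + u (u (v w))] is [- (v (p w) + p (v w))], which
   polarising [v (v w)] puts in the ideal. *)
apply: lyubich_half; rewrite mulrnDl -mulMnr !cubeU_polarized // mulNr -opprD.
exact/lyubichN/lyubich_VVU_polarized/mulUU.
Qed.

Lemma iter_lyubich k l : L l ->
  L (iter k (mul v) l) /\ iter k (mul n) l = iter k (mul v) l.
Proof.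
move=> Ll; elim: k => //= k [Lk ->].
by split; [exact: lyubich_mulV | rewrite lyubich_mul].
Qed.

End Barideal.

Lemma bounded_nil_barideal :
  bounded_nilpotent_mul mul V L ->
  bounded_nilpotent_mul mul (barideal omega) (barideal omega).
Proof.
(* Three multiplications reach the Lyubich ideal, and the other [k] act there as [L_v]. *)
move=> [k kL]; exists (k + 3) => n y n0 y0.
have [u [v [Uu Vv ->]]] := peirce_decomposition n0.
have [w [z [Uw Vz ->]]] := peirce_decomposition y0.
rewrite iterD /= !mulDr.
have Lw := lyubich_mulN3_U Uu Vv Uw; have Lz := lyubich_mulN3_V Uu Vv Vz.
by rewrite (iter_lyubich Uu Vv k (lyubichD Lw Lz)).2 kL //; exact: lyubichD.
Qed.

(** In the part linear in [t], [u] replaces one factor [v]. The two innermost replacements each give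
    [iter k.+1 (mul v) u], whence the factor 2; any other multiplies [u] by an element of the
    Lyubich ideal. [G] collects the higher terms. *)
Lemma iter_mul_perturbation u v k : U u -> V v ->
  exists2 G, polynomial_curve G &
    forall t, let x := v + t *: u in
      iter k.+1 (mul x) x =
        iter k.+1 (mul v) v + t *: (iter k.+1 (mul v) u *+ 2 + t *: G t).
Proof.
move=> Uu Vv.
have Lpow j : L (iter j.+1 (mul v) v).
  elim: j => [|j IHj]; first exact: lyubich_mulVV.
  by rewrite iterS; exact: lyubich_mulV.
elim: k => [|k [G Gc GE]].
  exists (fun=> u ** u); first exact: curve_cst.
  by move=> t x; rewrite /= sqrD !mulZr mulZl -addrA [in RHS]scalerDr scalerMnr.
pose d := iter k.+1 (mul v) u; pose a := iter k.+1 (mul v) v.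
have ua0 : u ** a = 0 by rewrite mulC (lyubich_mulU (Lpow k)).
exists (fun t => v ** G t + (u ** (d *+ 2) + t *: (u ** G t))).
  apply: curveD; first exact: curve_linear.
  by apply: curveD; [exact: curve_cst | apply/curve_shift/curve_linear].
move=> t x; rewrite iterS GE -/d -/a [iter k.+2 _ v]iterS [iter k.+2 _ u]iterS.
rewrite -/d -/a mulDl mulZl !(mulDr a) ua0 add0r !mulZr -addrA -scalerDr.
congr (_ + t *: _); rewrite !(mulDr (d *+ 2)) mulMnr !mulZr.
by rewrite -addrA -scalerDr.
Qed.

Lemma bounded_nil_mulV k u v :
  (forall x, omega x = 0 -> iter k.+1 (mul x) x = 0) ->
  U u -> V v -> iter k.+1 (mul v) u = 0.
Proof.
move=> nil Uu Vv; have [G Gc GE] := iter_mul_perturbation k Uu Vv.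
have dc : polynomial_curve (fun t => iter k.+1 (mul v) u *+ 2 + t *: G t).
  exact/curveD/curve_shift/Gc/curve_cst.
have [|_ d0] := curve_cons0 K_infinite (a := iter k.+1 (mul v) v) dc.
  move=> t _; rewrite -GE nil // linearD linearZ /=.
  by rewrite (peirceU_weight Uu) (peirceV_weight Vv) /= mulr0 addr0.
by have [/(double_eq0 two_neq0)] := curve_cons0 K_infinite Gc d0.
Qed.

End Idempotent.

(** * Principal powers and the identity at weight one *)

Lemma ppow_iter x k : ppow mul x k.+1 = iter k (mul x) x.
Proof. by rewrite /ppow /=; apply: eq_iter => y; exact: mulC. Qed.

Lemma bounded_nil_iter : bounded_nil mul (barideal omega) ->
  exists k, forall x, omega x = 0 -> iter k.+1 (mul x) x = 0.
Proof.
(* One multiplication beyond the nil-index is taken, so that the form [k.+1] also covers index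
   one. *)
move=> [[//|n] _ nil]; exists n => x x0.
by rewrite iterS -ppow_iter nil.
Qed.

(* f = x ** x is an idempotent and x = f + u + v with f ** u = u / 2 and
   u = - (2 u v + v^2), so that u lies in the Lyubich ideal. *)
Lemma train_identity k x :
  (forall x, omega x = 0 -> iter k.+1 (mul x) x = 0) -> omega x = 1 ->
  iter k.+1 (fun y => mul x y - 2%:R^-1 *: y) (x ** (x ** x) - x ** x) = 0.
Proof.
move=> nil x1; set f := x ** x.
have f_idem : f ** f = f by rewrite bernsteinE x1 expr1n scale1r.
have f1 : omega f = 1 by rewrite omegaM x1 mulr1.
have [|u [v [Uu Vv]]] := peirce_decomposition f_idem f1 (n := x - f).
  by rewrite linearB x1 f1 subrr.
move=> /(canRL (subrK _)); rewrite addrC => xE.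
have [+ _ _] := bernstein_peirce f_idem f1 Uu Vv; set nn := _ ** (u + v).
have nnE : nn = - u.
  apply/eqP; rewrite -addr_eq0 addrC; apply/eqP/(addrI f).
  rewrite addr0 -[RHS]/(x ** x) xE sqrD f_idem mulDr Vv addr0 Uu addrA //.
(* With [nn = - u] the relation [2 f nn + u u = nn] leaves [u u = 0]. *)
rewrite nnE mulNr mulNrn Uu => /(canRL (addNKr _)) uu0.
rewrite subrr in uu0.
have uE : u = - (v ** v) - (u ** v) *+ 2.
  by rewrite -[LHS]opprK -nnE /nn sqrD uu0 add0r opprD addrC.
have Lu : lyubich_ideal mul f u.
  have Lvvu := lyubich_VVU f_idem f1 Uu Vv.
  have Lvv := lyubich_mulVV f_idem f1 Vv Vv.
  (* One substitution of [uE] puts [v u] in the ideal; a second one then puts [u] there. *)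
  have Lvu : lyubich_ideal mul f (v ** u).
    rewrite uE mulDr !mulNr mulMnr [u ** v]mulC; apply: lyubichD; apply: lyubichN.
      exact: (lyubich_mulV f_idem f1).
    exact: lyubichMn.
  rewrite uE [u ** v]mulC; apply: lyubichD; apply: lyubichN => //.
  exact: lyubichMn.
have -> : x ** f - f = f ** u.
  by rewrite xE mulC !mulDr f_idem Vv addr0 addrC addKr.
have Lfu : lyubich_ideal mul f (f ** u) by apply: lyubich_half; rewrite Uu.
(* On the ideal [f] acts as one half and [u] as zero. *)
have shiftE l : lyubich_ideal mul f l -> x ** l - 2%:R^-1 *: l = v ** l.
  move=> Ll; rewrite xE mulDl (lyubich_mul Uu Vv Ll).
  rewrite -[X in _ *: X](lyubich_U Ll) -[X in _ *: X]scaler_nat scalerA mulVf //.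
  by rewrite scale1r addrC addKr.
have iterE j : iter j (fun y => x ** y - 2%:R^-1 *: y) (f ** u) =
    iter j (mul v) (f ** u).
  elim: j => //= j ->; rewrite shiftE //.
  exact: (iter_lyubich f_idem f1 Uu Vv j Lfu).1.
by rewrite iterE (bounded_nil_mulV f_idem f1 nil (lyubich_U Lfu) Vv).
Qed.

(** * Train polynomials *)

(** This is [p(L_x)] applied to [y]. Powers of one operator commute, so products of polynomials
    become compositions although [A] is not associative. At [y = x] the monomial of degree [j] gives
    the principal power of exponent [j + 1]. *)
Definition lmul_poly x (p : {poly K}) y :=
  \sum_(i < size p) p`_i *: iter i (mul x) y.

Lemma lmul_polyE n x (p : {poly K}) y : (size p <= n)%N ->
  lmul_poly x p y = \sum_(i < n) p`_i *: iter i (mul x) y.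
Proof.
move=> pn; rewrite /lmul_poly (big_ord_widen n (fun i => p`_i *: iter i (mul x) y) pn).
rewrite big_mkcond; apply: eq_bigr => i _; case: ltnP => // ip.
by rewrite nth_default ?scale0r.
Qed.

Lemma lmul_polyD x p q y : lmul_poly x (p + q) y = lmul_poly x p y + lmul_poly x q y.
Proof.
rewrite (lmul_polyE x y (size_polyD p q)) (lmul_polyE x y (leq_maxl _ (size q))).
rewrite (lmul_polyE x y (leq_maxr (size p) _)) -big_split.
by apply: eq_bigr => i _; rewrite coefD scalerDl.
Qed.

Lemma lmul_poly0 x y : lmul_poly x 0 y = 0.
Proof. by rewrite /lmul_poly size_poly0 big_ord0. Qed.

Lemma lmul_polyZ x c p y : lmul_poly x (c *: p) y = c *: lmul_poly x p y.
Proof.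
rewrite (lmul_polyE x y (size_scale_leq c p)) scaler_sumr.
by apply: eq_bigr => i _; rewrite coefZ scalerA.
Qed.

Lemma lmul_polyC x c y : lmul_poly x c%:P y = c *: y.
Proof. by rewrite (lmul_polyE x y (size_polyC_leq1 c)) big_ord1 coefC. Qed.

Lemma lmul_polyMX x p y : lmul_poly x (p * 'X) y = lmul_poly x p (x ** y).
Proof.
rewrite (lmul_polyE (n := (size p).+1)); last first.
  by rewrite (leq_trans (size_polyMleq _ _))// size_polyX addn2.
rewrite big_ord_recl coefMX scale0r add0r.
by apply: eq_bigr => i _; rewrite coefMX iterSr.
Qed.

Lemma lmul_poly_mul x p y : lmul_poly x p (x ** y) = x ** lmul_poly x p y.
Proof.
rewrite /lmul_poly linear_sum; apply: eq_bigr => i _ /=.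
by rewrite mulZr -iterSr iterS.
Qed.

Lemma lmul_polyM x p q y : lmul_poly x (p * q) y = lmul_poly x p (lmul_poly x q y).
Proof.
elim/poly_ind: p y => [|p c IHp] y; first by rewrite GRing.mul0r !lmul_poly0.
rewrite mulrDl mulrAC mul_polyC !lmul_polyD lmul_polyZ lmul_polyC !lmul_polyMX.
by rewrite IHp lmul_poly_mul.
Qed.

Lemma lmul_poly_XsubC x c y : lmul_poly x ('X - c%:P) y = x ** y - c *: y.
Proof.
by rewrite -[X in X - _]mul1r -polyCN lmul_polyD lmul_polyMX !lmul_polyC scale1r scaleNr.
Qed.

Lemma lmul_poly_exp_XsubC x c k y :
  lmul_poly x (('X - c%:P) ^+ k) y = iter k (fun z => x ** z - c *: z) y.
Proof.
elim: k => [|k IHk]; first by rewrite expr0 lmul_polyC scale1r.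
by rewrite exprS lmul_polyM IHk lmul_poly_XsubC.
Qed.

Lemma lmul_poly_Xsub1 x : lmul_poly x ('X - 1%:P) x = x ** x - x.
Proof. by rewrite lmul_poly_XsubC scale1r. Qed.

(** * Train equations and annihilating polynomials *)

Lemma iter_mulZ c k x y :
  iter k (mul (c *: x)) y = c ^+ k *: iter k (mul x) y.
Proof.
elim: k => [|k IHk]; first by rewrite expr0 scale1r.
by rewrite iterS IHk mulZl mulZr scalerA exprS.
Qed.

Lemma iter_mulZr c k x y : iter k (mul x) (c *: y) = c *: iter k (mul x) y.
Proof. by elim: k => //= k ->; rewrite mulZr. Qed.

(** Here [q] is the train polynomial divided by its variable, which reverses the indices: [gamma i]
    is the coefficient of degree [d - i]. *)
Lemma train_polyE d (gamma : nat -> K) (q : {poly K}) x : q`_d = 1 ->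
  (forall i, (0 < i <= d)%N -> gamma i = q`_(d - i)) ->
  ppow mul x d.+1 +
    \sum_(1 <= i < d.+1) (gamma i * omega x ^+ i) *: ppow mul x (d.+1 - i)%N =
  \sum_(j < d.+1) (q`_j * omega x ^+ (d - j)) *: iter j (mul x) x.
Proof.
move=> qd gammaE; rewrite (reindex_inj rev_ord_inj) /=.
pose F i := (q`_(d - i) * omega x ^+ i) *: iter (d - i) (mul x) x.
transitivity (\sum_(0 <= i < d.+1) F i); last first.
  rewrite big_mkord; apply: eq_bigr => i _.
  by rewrite subSS subKn // -ltnS ltn_ord.
rewrite [RHS]big_ltn // [F 0]/F subn0 qd expr0 mulr1 scale1r ppow_iter; congr (_ + _).
rewrite !big_nat; apply: eq_bigr => i /andP[i1 id].
by rewrite /F gammaE ?i1// subSn // ppow_iter.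
Qed.
Lemma weight_one : exists e, omega e = 1.
Proof.
case: A_bernstein => _ [[x x_neq0] _] _; exists ((omega x)^-1 *: x).
by rewrite linearZ /= mulVf.
Qed.

(* For omega x = 0 the homogenised identity is the value at t = 0 of a
   polynomial curve along x + t e. *)
Lemma annihilator_train d (q : {poly K}) : q`_d = 1 -> (size q <= d.+1)%N ->
  (forall x, omega x = 1 -> lmul_poly x q x = 0) ->
  exists gamma, train_equation mul omega d.+1 gamma.
Proof.
move=> qd qsize q0; exists (fun i => q`_(d - i)) => x.
rewrite (train_polyE (q := q)) //.
have nz y : omega y != 0 ->
    \sum_(j < d.+1) (q`_j * omega y ^+ (d - j)) *: iter j (mul y) y = 0.
  move=> y_neq0; set c := omega y; pose z := c^-1 *: y.
  have z1 : omega z = 1 by rewrite linearZ /= mulVf.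
  have yE : y = c *: z by rewrite scalerA mulfV // scale1r.
  (* The factor [c ^+ d.+1] splits into [c ^+ (d - j)], the power of the weight, and [c ^+ j.+1],
     from the [j + 1] factors [z] turned into [y]. *)
  have := q0 z z1; rewrite (lmul_polyE _ _ qsize) => /(congr1 ( *:%R (c ^+ d.+1))).
  rewrite scaler0 scaler_sumr => h; rewrite -[RHS]h; apply: eq_bigr => j _.
  rewrite [in iter _ _ _]yE iter_mulZ iter_mulZr !scalerA.
  congr (_ *: _); rewrite [in RHS]mulrC -!mulrA -exprSr -exprD addnS subnK //.
  by rewrite -ltnS.
have [x0|] := eqVneq (omega x) 0; last exact: nz.
have [e e1] := weight_one.
pose f t := \sum_(j < d.+1) (q`_j * t ^+ (d - j)) *:
  iter j (mul (x + t *: e)) (x + t *: e).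
suff : f 0 = 0 by rewrite /f x0 scale0r addr0.
apply: (curve_eq0 K_infinite) => [|t t_neq0]; last first.
  have te : omega (x + t *: e) = t by rewrite linearD linearZ x0 e1 add0r /= mulr1.
  by have := nz (x + t *: e); rewrite te; apply.
apply: curve_sum => j.
have iterc : polynomial_curve (fun t => iter j (mul (x + t *: e)) (x + t *: e)).
  elim: (j : nat) => [|i IHi].
    exact/curveD/curve_shift/curve_cst/curve_cst.
  have := curveD (curve_linear (mul x) IHi) (curve_shift (curve_linear (mul e) IHi)).
  by congr polynomial_curve; apply/funext => t; rewrite iterS mulDl mulZl.
have := curve_exp (d - j)%N (curve_linear ( *:%R q`_j) iterc).
by congr polynomial_curve; apply/funext => t; rewrite scalerA mulrC.
Qed.

Lemma train_annihilator d gamma : train_equation mul omega d.+1 gamma ->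
  exists2 q : {poly K}, q \is monic /\ size q = d.+1 &
    forall x, omega x = 1 -> lmul_poly x q x = 0.
Proof.
move=> train; pose q := \poly_(j < d.+1) (if j == d then 1 else gamma (d - j)%N).
have qd : q`_d = 1 by rewrite coef_poly ltnSn eqxx.
have qsize : size q = d.+1 by rewrite size_poly_eq // eqxx oner_eq0.
exists q; first by rewrite monicE /lead_coef qsize /= qd.
move=> x x1; rewrite -[RHS](train x) (train_polyE (q := q)) //.
  rewrite (lmul_polyE (n := d.+1)) ?qsize//.
  by apply: eq_bigr => j _; rewrite x1 expr1n mulr1.
move=> i /andP[i0 id]; rewrite coef_poly ltnS leq_subr subKn // ifN //.
by rewrite neq_ltn ltn_subrL i0 (leq_trans i0 id).
Qed.

Lemma train_algebraP : train_algebra mul omega <->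
  exists d gamma, (0 < d)%N /\ train_equation mul omega d.+1 gamma.
Proof.
split=> [[[|[|d]] [//= _ [gamma train] _]]|[d [gamma [d0 train]]]].
  by exists d.+1, gamma.
pose P s := (2 <= s)%N && `[< exists gamma, train_equation mul omega s gamma >].
have exP : exists s, P s by exists d.+1; rewrite /P ltnS d0; apply/asboolP; exists gamma.
have [r /andP[r2 /asboolP rtrain] rmin] := ex_minnP exP.
exists r; split=> // s delta s2 strain; apply: rmin.
by rewrite /P s2; apply/asboolP; exists delta.
Qed.

(** At weight zero only the leading power of the train equation survives. *)
Lemma train_bounded_nil : train_algebra mul omega -> bounded_nil mul (barideal omega).
Proof.
move=> /train_algebraP[d [gamma [_ train]]]; exists d.+1 => // x x0.
have := train x; rewrite big_nat big1 ?addr0// => i /andP[i0 _].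
by rewrite x0 expr0n gtn_eqF // mulr0 scale0r.
Qed.

(** * The minimal train polynomial *)

Definition train_poly k : {poly K} :=
  \prod_(a <- [:: 0, 1 & nseq k 2%:R^-1]) ('X - a%:P).

Lemma lmul_train_poly k x : lmul_poly x (train_poly k) x =
  iter k (fun y => x ** y - 2%:R^-1 *: y) (x ** (x ** x) - x ** x).
Proof.
rewrite /train_poly !big_cons mulrA mulrC lmul_polyM big_nseq iter_mulr_1.
rewrite mulrC lmul_polyM !lmul_poly_XsubC scale0r subr0 scale1r.
by rewrite -lmul_poly_exp_XsubC.
Qed.

(** [train_poly] is a product over a list of roots, so a monic divisor is given by a mask of that
    list. Beyond the first two entries all roots are one half, and only their number [c] matters. *)
Lemma dvdp_train_poly k (q : {poly K}) : q \is monic -> q %| train_poly k ->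
  exists (b0 b1 : bool) c,
    q = ('X - 0%:P) ^+ b0 * (('X - 1%:P) ^+ b1 * ('X - 2%:R^-1%:P) ^+ c).
Proof.
move=> qmonic /dvdp_prod_XsubC[m].
rewrite eqp_monic ?monic_prod_XsubC // => /eqP ->.
have maskX (a : K) j b s : \prod_(z <- mask (b :: s) (a :: j)) ('X - z%:P) =
    ('X - a%:P) ^+ b * \prod_(z <- mask s j) ('X - z%:P).
  by case: b; rewrite /= ?big_cons ?expr1 // expr0 GRing.mul1r.
case: m => [|b0 [|b1 s]].
- by exists false, false, 0; rewrite big_nil !expr0 !mulr1.
- by exists b0, false, 0; rewrite maskX mask0s big_nil !expr0 !mulr1.
exists b0, b1, (size (mask s (nseq k (2%:R^-1 : K)))).
rewrite !maskX; congr (_ * (_ * _)).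
have /all_pred1P -> : all (pred1 (2%:R^-1 : K)) (mask s (nseq k 2%:R^-1)).
  by apply/allP => z /mem_mask; rewrite mem_nseq => /andP[].
by rewrite size_nseq big_nseq iter_mulr_1.
Qed.

Lemma nil_train k : (forall x, omega x = 0 -> iter k.+1 (mul x) x = 0) ->
  forall x, omega x = 1 -> lmul_poly x (train_poly k.+1) x = 0.
Proof. by move=> nil x x1; rewrite lmul_train_poly train_identity. Qed.

Lemma bounded_nil_train : bounded_nil mul (barideal omega) -> train_algebra mul omega.
Proof.
move=> /bounded_nil_iter[k /nil_train q0]; apply/train_algebraP.
set q := train_poly _ in q0.
(* There are [k.+3] roots, hence size [k.+4], which is also the exponent of the leading power since
   the iteration starts at [x]. *)
have qsize : size q = k.+4.
  by rewrite size_prod_XsubC /= size_nseq.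
have qmonic : q \is monic by exact: monic_prod_XsubC.
have [gamma train] : exists gamma, train_equation mul omega k.+4 gamma.
  apply: annihilator_train q0; last by rewrite qsize.
  by move: qmonic; rewrite monicE /lead_coef qsize => /eqP.
by exists k.+3, gamma.
Qed.

Lemma lmul_poly_idem e q : e ** e = e -> lmul_poly e q e = q.[1] *: e.
Proof.
move=> e_idem; rewrite /lmul_poly horner_coef scaler_suml; apply: eq_bigr => i _.
by rewrite expr1n mulr1 iter_fix.
Qed.

(** The remainder also annihilates and, made monic, would give a train equation of smaller rank.
    Minimality concerns ranks from 2 on, so a constant remainder is excluded separately, by an
    element of weight one. *)
Lemma train_rank_dvdp r (q p : {poly K}) : train_rank mul omega r ->
  q \is monic -> size q = r ->
  (forall x, omega x = 1 -> lmul_poly x q x = 0) ->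
  (forall x, omega x = 1 -> lmul_poly x p x = 0) -> q %| p.
Proof.
move=> [r2 _ rmin] qmonic qsize q0 p0; apply/modp_eq0P/eqP/negPn/negP => rem_neq0.
set t := p %% q in rem_neq0.
have q_neq0 : q != 0 by exact: monic_neq0.
have tsize : (size t < r)%N by rewrite -qsize ltn_modp.
have t0 x : omega x = 1 -> lmul_poly x t x = 0.
  move=> x1; have := p0 x x1; rewrite {1}(divp_eq p q) lmul_polyD lmul_polyM q0 //.
  by rewrite /lmul_poly big1 ?add0r // => i _; rewrite (iter_fix _ (mul0r x)) scaler0.
case tE: (size t) tsize => [|[|d]] tr.
- by move/eqP: tE; rewrite size_poly_eq0 (negPf rem_neq0).
- have [e e1] := weight_one; have := t0 e e1.
  move: (size1_polyC (eq_leq tE)) rem_neq0 => ->; rewrite polyC_eq0 lmul_polyC.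
  move=> /negPf c_neq0 /eqP; rewrite scaler_eq0 c_neq0 => /eqP e0.
  by move: e1; rewrite e0 linear0 => /esym/eqP; rewrite oner_eq0.
have lead_neq0 : t`_d.+1 != 0.
  by have -> : t`_d.+1 = lead_coef t; rewrite ?lead_coef_eq0 // lead_coefE tE.
have [gamma train] : exists gamma, train_equation mul omega d.+2 gamma.
  apply: (annihilator_train (d := d.+1) (q := (t`_d.+1)^-1 *: t)) => [||x x1].
  - by rewrite coefZ mulVf.
  - by rewrite (leq_trans (size_scale_leq _ _)) // tE.
  - by rewrite lmul_polyZ t0 // scaler0.
by have := rmin d.+2 gamma isT train; rewrite leqNgt tr.
Qed.

(* On e + v the operator L_x - 1/2 acts as the scalar - 1/2 on V modulo U. *)
Lemma train_no_root0 c e : e ** e = e -> omega e = 1 ->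
  (forall x, omega x = 1 ->
     iter c (fun y => x ** y - 2%:R^-1 *: y) (x ** x - x) = 0) ->
  forall v, peirceV mul e v -> v = 0.
Proof.
move=> e_idem e1 train v Vv; set x := e + v.
have x1 : omega x = 1.
  by rewrite linearD e1 (peirceV_weight e1 Vv) /= addr0.
have xx : x ** x - x = v ** v + (- 1) *: v.
  by rewrite sqrD e_idem Vv mul0rn addr0 scaleN1r opprD addrACA subrr add0r.
have := train x x1; rewrite xx.
have UV := mulUV e_idem e1; have Uvv := mulVV e_idem e1 Vv Vv.
have iterE j : exists w a, [/\ peirceU mul e w, a != 0 &
    iter j (fun y => x ** y - 2%:R^-1 *: y) (v ** v + (- 1) *: v) = w + a *: v].
  elim: j => [|j [w [a [Uw a_neq0 jE]]]].
    by exists (v ** v), (- 1); rewrite oppr_eq0 oner_eq0.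
  exists (w ** v + a *: (v ** v)), (- (2%:R^-1 * a)); split.
  - by apply: peirceUD; [exact: UV | exact: peirceUZ].
  - by rewrite oppr_eq0 mulf_neq0 // invr_eq0.
  rewrite iterS jE /x mulDl !mulDr !mulZr Vv scaler0 addr0 scalerDr.
  have {1}<- : 2%:R^-1 *: w = e ** w.
    by rewrite -[X in _ *: X]Uw -[X in _ *: X]scaler_nat scalerA mulVf // scale1r.
  rewrite -[_ - _]addrA [X in _ + X = _]addrC opprD !addrA subrr add0r.
  by rewrite -addrA addrC scalerA scaleNr [v ** w]mulC.
have [w [a [Uw a_neq0 ->]]] := iterE c => /eqP; rewrite addrC addr_eq0 => /eqP av.
have av0 : a *: v = 0.
  apply: peirceUV_eq0 (_ : peirceV mul e _).
    by rewrite av; exact: peirceUN.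
  by rewrite /peirceV /= mulZr Vv scaler0.
by move/eqP: av0; rewrite scaler_eq0 (negPf a_neq0) => /eqP.
Qed.

(** If V is zero, every [x] of weight one is idempotent: [x = e + u] squares to [e + u + u u], and
    [u u] lies in V. *)
Lemma train_rank2 e : e ** e = e -> omega e = 1 ->
  (forall v, peirceV mul e v -> v = 0) ->
  exists gamma, train_equation mul omega 2 gamma.
Proof.
move=> e_idem e1 V0; apply: (annihilator_train (q := 'X - 1%:P)) => [||x x1].
- by rewrite coefB coefX coefC subr0.
- by rewrite size_XsubC.
have [|u [v [Uu /V0 ->]]] := peirce_decomposition e_idem e1 (n := x - e).
  by rewrite linearB x1 e1 /= subrr.
rewrite addr0 => /(canRL (subrK _)) ->; rewrite lmul_poly_Xsub1 sqrD e_idem [u ** e]mulC Uu.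
have /V0 -> := mulUU e_idem e1 Uu Uu.
by rewrite add0r subrr.
Qed.

Lemma train_equation_form e r : e ** e = e -> omega e = 1 ->
  train_rank mul omega r -> (3 <= r)%N -> forall x : A,
    iter (r - 3) (fun y => x ** y - (2%:R^-1 * omega x) *: y)
      (ppow mul x 3 - omega x *: ppow mul x 2) = 0.
Proof.
case: r => [//|d] e_idem e1 rank r3.
have [k nil] : exists k, forall x, omega x = 0 -> iter k.+1 (mul x) x = 0.
  by apply/bounded_nil_iter/train_bounded_nil; exists d.+1.
have [r2 [gamma train] rmin] := rank.
have [q [qmonic qsize] q0] := train_annihilator train.
have q_dvd := train_rank_dvdp rank qmonic qsize q0 (nil_train nil).
have [b0 [b1 [c qE]]] := dvdp_train_poly qmonic q_dvd.
(* At the idempotent [e] the annihilation reads [q.[1] = 0]; without the factor [X - 1] this value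
   would be a power of one half. *)
have b1T : b1.
  have := q0 e e1; rewrite (lmul_poly_idem _ e_idem) => /eqP; rewrite scaler_eq0.
  case/orP => [|/eqP e0]; last first.
    by move: e1; rewrite e0 linear0 => /esym/eqP; rewrite oner_eq0.
  apply: contraLR => /negPf b1F; rewrite qE b1F expr0 GRing.mul1r !hornerE.
  rewrite subr0 expr1n GRing.mul1r expf_neq0 // subr_eq0 eq_sym invr_eq1.
  by rewrite -subr_eq0 mulr2n addrK oner_neq0.
pose half_shift x y := x ** y - 2%:R^-1 *: y.
have qval x : lmul_poly x q x = iter c (half_shift x)
    (if b0 then x ** (x ** x) - x ** x else x ** x - x).
  rewrite qE b1T mulrC lmul_polyM.
  rewrite mulrC lmul_polyM lmul_poly_exp_XsubC.
  case: (b0); rewrite ?expr1 ?expr0 ?lmul_poly_XsubC ?lmul_polyC ?scale1r ?scale0r ?subr0 //.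
have csize : d.+1 = (b0 + c).+2.
  rewrite -qsize qE b1T.
  rewrite !size_monicM ?monic_exp ?monicXsubC ?mulf_neq0 ?expf_neq0 ?polyXsubC_eq0 //.
  by rewrite !size_exp_XsubC !addSn !addnS.
have b0T : b0.
  apply: contraT => /negPf b0F; rewrite b0F in qval.
  have V0 : forall v, peirceV mul e v -> v = 0.
    by apply: (train_no_root0 e_idem e1 (c := c)) => x x1; rewrite -qval q0.
  have [delta train2] := train_rank2 e_idem e1 V0.
  by have := rmin 2 delta isT train2; rewrite leqNgt r3.
rewrite b0T in qval csize => x.
have -> : (d.+1 - 3)%N = c by rewrite csize [(true + c)%N]add1n !subSS subn0.
(* At weight zero the claim says that the principal power of exponent [c + 3], the rank, vanishes;
   this is the train equation there. Other weights are scaled to one. *)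
have [x0|x_neq0] := eqVneq (omega x) 0.
  rewrite x0 mulr0 scale0r subr0.
  have -> : iter c (fun y => x ** y - 0 *: y) (ppow mul x 3) = iter (c + 2) (mul x) x.
    rewrite iterD ppow_iter; apply: eq_iter => y.
    by rewrite scale0r subr0.
  have := train x; rewrite csize [(true + c)%N]add1n ppow_iter addn2.
  rewrite big_nat big1 ?addr0// => i /andP[i0 _].
  by rewrite x0 expr0n gtn_eqF // mulr0 scale0r.
set a := omega x in x_neq0 *.
have [y y1 xE] : exists2 y, omega y = 1 & x = a *: y.
  exists (a^-1 *: x); first by rewrite linearZ /= mulVf.
  by rewrite scalerA mulfV // scale1r.
have iterE j z : iter j (fun z => x ** z - (2%:R^-1 * a) *: z) z =
    a ^+ j *: iter j (fun z => y ** z - 2%:R^-1 *: z) z.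
  elim: j => [|j /= ->]; first by rewrite scale1r.
  rewrite {1}xE mulZl mulZr !scalerA scalerBr !scalerA exprS.
  by rewrite -[_ * a * _]mulrA [2%:R^-1 * _]mulrC.
have iterZ j b z : iter j (fun z => y ** z - 2%:R^-1 *: z) (b *: z) =
    b *: iter j (fun z => y ** z - 2%:R^-1 *: z) z.
  elim: j => //= j ->.
  by rewrite mulZr [_ *: (b *: _)]scalerA mulrC -scalerA -scalerBr.
rewrite iterE !ppow_iter /= xE !(mulZl, mulZr) !scalerA !mulrA -scalerBr iterZ.
by rewrite -qval q0 // !scaler0.
Qed.

End Bernstein.

Theorem theorem4p10 (K : fieldType) (A : lmodType K)
    (mul : {bilinear A -> A -> A}) (omega : {scalar A}) (e : A)
    (K_infinite : infinite_set [set: K])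
    (char_neq2 : 2%N \notin [pchar K]) (char_neq3 : 3%N \notin [pchar K])
    (A_bernstein : bernstein_algebra mul omega)
    (e_neq0 : e != 0) (e_idem : mul e e = e) :
  [<-> train_algebra mul omega;
       bounded_nilpotent_mul mul (peirceV mul e) (peirceU mul e);
       bounded_nilpotent_mul mul (peirceV mul e) (lyubich_ideal mul e);
       bounded_nilpotent_mul mul (barideal omega) (barideal omega);
       bounded_nil mul (barideal omega)] /\
  (forall r : nat, train_rank mul omega r -> (3 <= r)%N ->
     forall x : A,
       iter (r - 3) (fun y => mul x y - (2%:R^-1 * omega x) *: y)
         (ppow mul x 3 - omega x *: ppow mul x 2) = 0).
Proof.
have two_neq0 : 2%:R != 0 :> K by apply: contra char_neq2 => two0; rewrite inE.
(* The scalar [omega e] equals its square; if it were 0, the Bernstein identity at [e] would give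
   [e = 0]. *)
have omega_e : omega e = 1.
  case: (A_bernstein) => _ [_ omegaM] sqE; have := congr1 omega e_idem.
  rewrite omegaM => /eqP; rewrite -subr_eq0 -[X in _ - X]mulr1 -mulrBr mulf_eq0.
  case/orP => [/eqP e0|]; last by rewrite subr_eq0 => /eqP.
  by have := sqE e; rewrite !e_idem e0 expr0n scale0r => /eqP; rewrite (negPf e_neq0).
split; last by move=> r; exact: (train_equation_form K_infinite two_neq0 A_bernstein e_idem).
tfae.
- move=> /train_bounded_nil/(bounded_nil_iter A_bernstein)[k nil].
  exists k.+1 => v u Vv Uu.
  exact: (bounded_nil_mulV K_infinite two_neq0 A_bernstein e_idem omega_e nil).
- by move=> [k nil]; exists k => v u Vv [Uu _]; exact: nil.
- exact: (bounded_nil_barideal K_infinite two_neq0 A_bernstein).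
(* The power of exponent [k.+1] is [L_x] applied [k] times to [x] itself. *)
- move=> [k nil]; exists k.+1 => // x x0.
  rewrite (ppow_iter A_bernstein); exact: nil.
- exact: (bounded_nil_train K_infinite two_neq0 A_bernstein).
Qed.
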